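(* Let $Z$ be an infinite field of arbitrary characteristic, let $D$ be a finite-dimensional central division algebra over $Z$, and let $Z[X] = Z[u_1,\ldots,u_q]$, $Z(X)$, $D[X]$, $D(X)$ and the affine space $X$ be as defined in the context. Let $K \subseteq D(X)$ be a (commutative) extension field of $Z(X)$, and for $\lambda \in X$ let $\overline{K}_\lambda \subseteq D$ be the specialization of $K$ along $\lambda$. (1) For every $\lambda \in X$, the specialization $\overline{K}_\lambda$ is an extension field of $Z$, and for generic $\lambda \in X$ we have $[\overline{K}_\lambda : Z] = [K : Z(X)]$. In particular, if $K$ is a maximal commutative subfield of $D(X)$, then $\overline{K}_\lambda$ is a maximal subfield of $D$ for generic $\lambda\in X$. (2) If $K$ is Galois over $Z(X)$, then $\overline{K}_\lambda$ is Galois over $Z$ for generic $\lambda \in X$. If $\mathrm{char}(Z) = p > 0$, we have in addition: (3) If $K$ is purely inseparable of exponent $r$ over $Z(X)$, then for every $\lambda \in X$, $\overline{K}_\lambda$ is purely inseparable over $Z$, of exponent $\leq r$; equality holds for generic $\lambda \in X$. (4) If $K$ is Galois over $Z(X)$ with Galois group isomorphic to $(\mathbb{Z}/p\mathbb{Z})^r$, then for generic $\lambda \in X$, $\overline{K}_\lambda$ is Galois over $Z$ with $\mathrm{Gal}(\overline{K}_\lambda/Z) \simeq (\mathbb{Z}/p\mathbb{Z})^r$.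
   Context: $Z[X] = Z[u_1,\ldots,u_q]$ is a polynomial ring in $q$ variables over $Z$ and $Z(X)$ is its fraction field. $X$ also denotes the set of $Z$-algebra homomorphisms $\lambda : Z[X] \to Z$, identified with $\mathbb{A}^q(Z) = Z^q$ (the point $(\lambda_1,\ldots,\lambda_q)$ corresponds to evaluation $f \mapsto f(\lambda_1,\ldots,\lambda_q)$) and endowed with the Zariski topology. A property depending on $\lambda \in X$ holds generically, or for generic $\lambda$, if it holds for all $\lambda$ in some non-empty Zariski open subset of $X$. Put $D[X] := D \otimes_Z Z[X]$; it has a skewfield of fractions $D(X) \simeq D \otimes_Z Z(X)$, whose centre is $Z(X)$. For $\lambda \in X$, $\pi_\lambda : D[X] \to D$ is the algebra homomorphism with $\pi_\lambda(d \otimes f) = \lambda(f) d$. For a $Z(X)$-subspace $V \subseteq D(X)$, its specialization along $\lambda$ is $\overline{V}_\lambda := \pi_\lambda(V \cap D[X]) \subseteq D$. A (commutative) subfield $F$ of a division ring $R$ is maximal if its centralizer $C_R(F)$ equals $F$. A purely inseparable finite extension $E/F$ in characteristic $p$ has exponent $r$ if $r\ge 0$ is the smallest integer with $x^{p^r} \in F$ for all $x \in E$. *)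

(* Defs.v *)
From HB Require Import structures.
From mathcomp Require Import all_boot all_order all_algebra all_fingroup.
From mathcomp Require Import all_field.
From mathcomp Require Import mpoly.
From Stdlib Require Import Classical ClassicalEpsilon.

Set Implicit Arguments.
Unset Strict Implicit.
Unset Printing Implicit Defensive.

Import GRing.Theory VectorInternalTheory.
Local Open Scope ring_scope.

(* The tensor product D (x)_F R, for D a finite-dimensional F-algebra and R a *)
(* commutative ring made into an F-algebra by phi.  An element is given by    *)
(* its coordinates in R on the F-basis of D underlying v2r/r2v, and products  *)
(* are computed from the structure constants of D in that basis.  See esc_tM  *)
(* and esc_universal.  The argument phi does not occur in the carrier, but    *)
(* the ring structure declared below depends on it.                           *)
Definition extend_scalars (F : fieldType) (D : falgType F) (R : comNzRingType)
    (phi : {rmorphism F -> R}) : Type :=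
  'rV[R]_(dim D).

Section ExtendScalars.

Variables (F : fieldType) (D : falgType F) (R : comNzRingType).
Variable phi : {rmorphism F -> R}.

Local Notation DR := (extend_scalars D phi).

HB.instance Definition _ := GRing.Lmodule.copy DR 'rV[R]_(dim D).
HB.instance Definition _ := Vector.copy DR 'rV[R]_(dim D).

Implicit Types x y z : DR.

Definition esc_basis (i : 'I_(dim D)) : D := r2v (delta_mx 0 i).

(* d |-> d (x) 1 *)
Definition esc_incl (d : D) : DR := map_mx phi (v2r d).

Definition esc_mul x y : DR :=
  \sum_i \sum_j (x 0 i * y 0 j) *: esc_incl (esc_basis i * esc_basis j).

Lemma esc_incl_additive (a b : D) : esc_incl (a + b) = esc_incl a + esc_incl b.
Proof. by rewrite /esc_incl linearD /= map_mxD. Qed.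

Lemma esc_incl_scale c (a : D) : esc_incl (c *: a) = phi c *: esc_incl a.
Proof. by rewrite /esc_incl linearZ /= map_mxZ. Qed.

Lemma esc_incl_sum (I : finType) (a : I -> D) :
  esc_incl (\sum_i a i) = \sum_i esc_incl (a i).
Proof.
apply: (big_morph esc_incl esc_incl_additive).
by rewrite /esc_incl linear0 map_mx0.
Qed.

Lemma esc_basisE (d : D) : d = \sum_i (v2r d) 0 i *: esc_basis i.
Proof.
rewrite -{1}[d]v2rK {1}[v2r d]row_sum_delta linear_sum /=.
by apply: eq_bigr => i _; rewrite linearZ.
Qed.

Lemma esc_decomp x : x = \sum_i x 0 i *: esc_incl (esc_basis i).
Proof.
rewrite {1}[x]row_sum_delta; apply: eq_bigr => i _; congr (_ *: _).
rewrite /esc_incl /esc_basis r2vK; apply/rowP=> j.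
by rewrite !mxE rmorph_nat.
Qed.

Lemma esc_mulDl : left_distributive esc_mul +%R.
Proof.
move=> x y z; rewrite /esc_mul -big_split; apply: eq_bigr => i _ /=.
rewrite -big_split; apply: eq_bigr => j _ /=.
by rewrite mxE mulrDl scalerDl.
Qed.

Lemma esc_mulDr : right_distributive esc_mul +%R.
Proof.
move=> x y z; rewrite /esc_mul -big_split; apply: eq_bigr => i _ /=.
rewrite -big_split; apply: eq_bigr => j _ /=.
by rewrite mxE mulrDr scalerDl.
Qed.

Lemma esc_mulZl a x y : a *: esc_mul x y = esc_mul (a *: x) y.
Proof.
rewrite /esc_mul scaler_sumr; apply: eq_bigr => i _.
rewrite scaler_sumr; apply: eq_bigr => j _.
by rewrite mxE scalerA mulrA.
Qed.

Lemma esc_mulZr a x y : a *: esc_mul x y = esc_mul x (a *: y).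
Proof.
rewrite /esc_mul scaler_sumr; apply: eq_bigr => i _.
rewrite scaler_sumr; apply: eq_bigr => j _.
by rewrite mxE scalerA mulrCA.
Qed.

Lemma esc_inclM (a b : D) : esc_incl (a * b) = esc_mul (esc_incl a) (esc_incl b).
Proof.
rewrite {1}[a]esc_basisE {1}[b]esc_basisE mulr_suml esc_incl_sum.
apply: eq_bigr => i _; rewrite mulr_sumr esc_incl_sum; apply: eq_bigr => j _.
by rewrite -scalerAl -scalerAr scalerA esc_incl_scale rmorphM !mxE.
Qed.

Lemma esc_mul_suml (I : finType) (f : I -> DR) y :
  esc_mul (\sum_i f i) y = \sum_i esc_mul (f i) y.
Proof.
apply: (big_morph (esc_mul^~ y)) => [u v|]; first exact: esc_mulDl.
by rewrite -(scale0r 0) -esc_mulZl !scale0r.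
Qed.

Lemma esc_mul_sumr (I : finType) (f : I -> DR) y :
  esc_mul y (\sum_i f i) = \sum_i esc_mul y (f i).
Proof.
apply: (big_morph (esc_mul y)) => [u v|]; first exact: esc_mulDr.
by rewrite -(scale0r 0) -esc_mulZr !scale0r.
Qed.

Lemma esc_mulA : associative esc_mul.
Proof.
move=> x y z.
have coords u : exists a, u = \sum_i a i *: esc_incl (esc_basis i).
  by exists (u 0); apply: esc_decomp.
case: (coords x) (coords y) (coords z) => [a ->] [b ->] [c ->].
rewrite [LHS]esc_mul_suml [X in _ = esc_mul X _]esc_mul_suml [RHS]esc_mul_suml.
apply: eq_bigr => i _.
rewrite [X in esc_mul _ X = _]esc_mul_suml [LHS]esc_mul_sumr.
rewrite [X in _ = esc_mul X _]esc_mul_sumr [RHS]esc_mul_suml.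
apply: eq_bigr => j _.
rewrite [X in esc_mul _ X = _]esc_mul_sumr [LHS]esc_mul_sumr [RHS]esc_mul_sumr.
apply: eq_bigr => k _.
rewrite -!(esc_mulZl, esc_mulZr) -!esc_inclM mulrA !scalerA.
by congr (_ *: _); rewrite -[RHS]mulrA [RHS]mulrC.
Qed.

Lemma esc_mul1l : left_id (esc_incl 1) esc_mul.
Proof.
move=> x; rewrite [x in LHS]esc_decomp [RHS]esc_decomp esc_mul_sumr.
by apply: eq_bigr => i _; rewrite -esc_mulZr -esc_inclM mul1r.
Qed.

Lemma esc_mul1r : right_id (esc_incl 1) esc_mul.
Proof.
move=> x; rewrite [x in LHS]esc_decomp [RHS]esc_decomp esc_mul_suml.
by apply: eq_bigr => i _; rewrite -esc_mulZl -esc_inclM mulr1.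
Qed.

Lemma esc_one_neq0 : esc_incl 1 != 0.
Proof.
apply: contra_neq (oner_neq0 D) => /rowP e0.
apply: v2r_inj; rewrite linear0; apply/rowP => i.
by move: (e0 i); rewrite !mxE => /eqP; rewrite fmorph_eq0 => /eqP.
Qed.

HB.instance Definition _ := GRing.Zmodule_isNzRing.Build DR
  esc_mulA esc_mul1l esc_mul1r esc_mulDl esc_mulDr esc_one_neq0.
HB.instance Definition _ :=
  GRing.Lmodule_isLalgebra.Build R DR esc_mulZl.
HB.instance Definition _ :=
  GRing.Lalgebra_isAlgebra.Build R DR esc_mulZr.

(* the pure tensor d (x) r *)
Definition esc_tensor (d : D) (r : R) : DR := r *: esc_incl d.

Lemma esc_tM a b r s :
  esc_tensor a r * esc_tensor b s = esc_tensor (a * b) (r * s).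
Proof. by rewrite -scalerAl -scalerAr scalerA /esc_tensor esc_inclM. Qed.

Lemma esc_universal (V : lmodType R) (f : D -> V) :
    (forall a b, f (a + b) = f a + f b) ->
    (forall c a, f (c *: a) = phi c *: f a) ->
  exists2 g : {linear DR -> V},
    forall d r, g (esc_tensor d r) = r *: f d &
    forall h : {linear DR -> V},
      (forall d r, h (esc_tensor d r) = r *: f d) -> h =1 g.
Proof.
move=> fD fZ; pose g x := \sum_i x 0 i *: f (esc_basis i).
have lin_g : linear (g : DR -> V).
  move=> a x y; rewrite /g scaler_sumr -big_split; apply: eq_bigr => i _ /=.
  by rewrite !mxE scalerDl scalerA.
pose gL := GRing.isLinear.Build R DR V *:%R g lin_g.
pose g' : {linear DR -> V} := HB.pack g gL.
have f0 : f 0 = 0 by rewrite -(scale0r 0) fZ rmorph0 scale0r.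
exists g' => [d r | h hE x].
  rewrite /esc_tensor linearZ /=; congr (_ *: _).
  rewrite [in RHS](esc_basisE d) (big_morph f fD f0); apply: eq_bigr => i _.
  by rewrite fZ mxE.
rewrite [x in LHS]esc_decomp linear_sum; apply: eq_bigr => i _.
exact: hE.
Qed.

End ExtendScalars.

HB.instance Definition _ (F : fieldType) (D : falgType F) (K : fieldType)
    (phi : {rmorphism F -> K}) :=
  Algebra_isFalgebra.Build K (extend_scalars D phi).

Section GenericAlgebra.

Variables (Z : fieldType) (D : falgType Z) (q : nat).

Definition ratfun_const : {rmorphism Z -> {fraction {mpoly Z[q]}}} :=
  @tofrac {mpoly Z[q]} \o @mpolyC q Z.

(* D[X] and D(X) *)
Definition poly_alg := extend_scalars D (@mpolyC q Z).
Definition ratfun_alg := extend_scalars D ratfun_const.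

(* D[X] -> D(X), d (x) f |-> d (x) f/1; see poly_alg_incl_tensor *)
Definition poly_alg_incl (a : poly_alg) : ratfun_alg :=
  map_mx (@tofrac {mpoly Z[q]}) a.

Lemma poly_alg_incl_tensor d f :
  poly_alg_incl (esc_tensor _ d f) = esc_tensor ratfun_const d (tofrac f).
Proof. by apply/rowP => i; rewrite !mxE rmorphM. Qed.

(* pi_lambda, for lambda the evaluation at a point of Z^q; see eval_alg_tensor *)
Definition eval_alg (lam : 'I_q -> Z) (a : poly_alg) : D :=
  r2v (map_mx (meval lam) a).

Lemma eval_alg_tensor lam d f : eval_alg lam (esc_tensor _ d f) = f.@[lam] *: d.
Proof.
apply: v2r_inj; rewrite r2vK linearZ /=.
by apply/rowP => i; rewrite !mxE mevalM mevalC.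
Qed.

Definition in_specialization (V : {vspace ratfun_alg}) (lam : 'I_q -> Z) (d : D) :=
  exists2 a : poly_alg, poly_alg_incl a \in V & eval_alg lam a = d.

Lemma in_specialization0 V lam : in_specialization V lam 0.
Proof.
exists 0; last by rewrite /eval_alg map_mx0 linear0.
by rewrite /poly_alg_incl map_mx0 mem0v.
Qed.

Lemma in_specializationP V lam c u v :
  in_specialization V lam u -> in_specialization V lam v ->
  in_specialization V lam (c *: u + v).
Proof.
move=> [a aV <-] [b bV <-]; exists (c%:MP *: a + b).
  have -> : poly_alg_incl (c%:MP *: a + b)
            = tofrac c%:MP *: poly_alg_incl a + poly_alg_incl b.
    by apply/rowP => i; rewrite !mxE rmorphD rmorphM.
  by rewrite memvD ?memvZ.
apply: v2r_inj; rewrite linearP /= !r2vK; apply/rowP => i.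
by rewrite !mxE mevalD mevalM mevalC.
Qed.

(* The set in_specialization V lam is a Z-subspace of D, but membership in    *)
(* it is not given by a boolean test; hence the use of epsilon.               *)
Definition specialization (V : {vspace ratfun_alg}) (lam : 'I_q -> Z) :
    {vspace D} :=
  epsilon (inhabits 0%VS)
    (fun W : {vspace D} => forall d, d \in W <-> in_specialization V lam d).

Lemma specializationP V lam d :
  d \in specialization V lam <-> in_specialization V lam d.
Proof.
move: d; pose spec (W : {vspace D}) :=
  forall d, d \in W <-> in_specialization V lam d.
apply: (epsilon_spec (inhabits 0%VS) spec).
pose sub (W : {vspace D}) := forall d, d \in W -> in_specialization V lam d.
have sub0 : sub 0%VS.
  by move=> d; rewrite memv0 => /eqP ->; apply: in_specialization0.
suff: forall m (W : {vspace D}), sub W -> (\dim {:D} - \dim W <= m)%N ->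
    exists W, spec W.
  by move=> maxW; apply: (maxW (\dim {:D}) 0%VS sub0); rewrite leq_subr.
elim=> [|m IHm] W subW dimW.
  exists W => d; split=> [/subW //|_].
  suff /eqP -> : W == fullv by rewrite memvf.
  by rewrite eqEdim subvf -subn_eq0 -leqn0.
case: (classic (exists2 d, in_specialization V lam d & d \notin W)).
  move=> [d dS dW]; apply: (IHm (W + <[d]>)%VS).
    move=> _ /memv_addP [w wW [_ /vlineP [c ->] ->]].
    by rewrite addrC; apply: in_specializationP => //; apply: subW.
  have ltW : (\dim W < \dim (W + <[d]>)%VS)%N.
    rewrite ltn_neqAle dimvS ?addvSl // andbT; apply: contra dW => /eqP eqd.
    have/eqP -> : W == (W + <[d]>)%VS by rewrite eqEdim addvSl -eqd leqnn.
    by apply: (subvP (addvSr W _)); apply: memv_line.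
  rewrite -ltnS; apply: leq_trans dimW; apply: ltn_sub2l => //.
  by apply: leq_trans ltW (dimvS (subvf _)).
move=> maxW; exists W => d; split=> [/subW //|dS].
by apply: contraT => dW; case: maxW; exists d.
Qed.

End GenericAlgebra.

Section Zariski.

Variables (Z : fieldType) (q : nat).
Implicit Type U P : ('I_q -> Z) -> Prop.

(* complements of zero loci of sets of polynomials *)
Definition zariski_open U :=
  exists S : {mpoly Z[q]} -> Prop,
    forall lam, U lam <-> exists2 f, S f & f.@[lam] != 0.

Definition generically P :=
  exists U, [/\ zariski_open U, exists lam, U lam & forall lam, U lam -> P lam].

End Zariski.

Section Subfields.

Variables (F : fieldType) (A : falgType F).
Implicit Type V : {vspace A}.

Definition extension_field V : Prop :=
  [/\ 1 \in V,
      {in V &, forall x y, x * y \in V},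
      {in V &, forall x y, x * y = y * x} &
      {in V, forall x, x != 0 -> exists2 y, y \in V & x * y = 1}].

Definition maximal_subfield V : Prop :=
  extension_field V /\ 'C(V)%VS = V.

(* Field-theoretic notions are defined in the library for an extension field  *)
(* L : fieldExtType F rather than for a subspace of an algebra; V is viewed   *)
(* as an extension of F through an algebra isomorphism from such an L onto V  *)
(* (algebra morphisms from a field are injective).                            *)
Definition galois_ext V : Prop :=
  exists (L : splittingFieldType F) (f : 'AHom(L, A)),
    limg f = V /\ galois 1 {:L}.

Definition galois_ext_group V (gT : finGroupType) (G : {group gT}) : Prop :=
  exists (L : splittingFieldType F) (f : 'AHom(L, A)),
    [/\ limg f = V, galois 1 {:L} & 'Gal({:L} / 1) \isog G].

Definition pinsep_ext V : Prop :=
  exists (L : fieldExtType F) (f : 'AHom(L, A)),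
    limg f = V /\ purely_inseparable 1 {:L}.

Definition pinsep_ext_exponent (p : nat) V (r : nat) : Prop :=
  [/\ pinsep_ext V,
      {in V, forall x, x ^+ (p ^ r) \in 1%VS} &
      forall s, {in V, forall x, x ^+ (p ^ s) \in 1%VS} -> (r <= s)%N].

End Subfields.

(* Main.v *)
(* Express K by elements of D[X], clearing denominators.  A relation         *)
(* between elements of D[X] persists under every specialization, and linear   *)
(* independence over Z(X) persists generically, since a nonzero minor of the  *)
(* coordinate matrix remains nonzero at a generic point.  Conversely, lifts   *)
(* of independent elements are independent.  Applied to a basis of K this     *)
(* gives the generic dimension; applied to the commutators of a basis of K    *)
(* with a basis of a complement of C(K) it gives dim C(K_lam) <= dim C(K),    *)
(* hence maximality.                                                          *)
(*   In the Galois case, let y generate K with all conjugates a_s in D[X].    *)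
(* The product of the X - a_s has coefficients in D[X] /\ Z(X) = Z[X], so its *)
(* specialization lies in Z[T] and splits in K_lam; generically the           *)
(* specialized conjugates are distinct and one of them generates K_lam.  A    *)
(* relation e a_(ts) = sum_i Q_(t,i) a_s^i over Z[X] determines the group law *)
(* and also specializes, so that the Galois group is preserved.               *)

(* Each generic assertion is reduced to the nonvanishing of a single nonzero polynomial, so that
   finitely many conditions combine by multiplication; over an infinite field such a polynomial has
   a nonzero value ([generically_nonvanishing]). Passage between D(X) and D rests on
   [generic_independence] and [independence_of_eval], both read off from minors of a coordinate
   matrix. The specialization of a field is a field at every point: commutation is a relation in
   D[X], and a finite-dimensional subalgebra of a division algebra contains its inverses. In the
   inseparable case, that x^(p^r) is a scalar survives every specialization, because D[X] meets Z(X)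
   in Z[X] ([poly_alg_incl_scalar]); an element whose p^(r-1)-th power is not a scalar keeps this
   property generically ([eval_generic_nonscalar]), so the exponent does not drop. In the Galois
   case, [galois_ext_group_of_conjugates] isolates the data on conjugates that determine the
   extension and its group, and [galois_specialization] shows that they specialize. *)
Require Import Defs.
From HB Require Import structures.
From mathcomp Require Import all_boot all_order all_algebra all_fingroup.
From mathcomp Require Import all_field.
From mathcomp Require Import mpoly.
From Stdlib Require Import Classical.

Set Implicit Arguments.
Unset Strict Implicit.
Unset Printing Implicit Defensive.

Import GRing.Theory VectorInternalTheory.
Local Open Scope ring_scope.

(** * Subfields of an algebra *)

Section SubalgebraFields.

Variables (F : fieldType) (A : falgType F).
Implicit Types V : {vspace A}.

(** Left multiplication by a nonzero x is injective on the finite-dimensional space V, hence maps V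
    onto itself and reaches 1. *)
Lemma subalgebra_extension_field V :
    (forall x : A, x != 0 -> x \is a GRing.unit) ->
    1 \in V -> {in V &, forall x y, x * y \in V} ->
    {in V &, forall x y, x * y = y * x} ->
  extension_field V.
Proof.
move=> divA V1 VM VC; split=> // x Vx nz_x.
have sxV : (amull x @: V <= V)%VS.
  by apply/subvP=> _ /memv_imgP[y Vy ->]; rewrite lfunE /= VM.
have xV : (amull x @: V)%VS = V.
  apply/eqP; rewrite eqEdim sxV limg_dim_eq ?leqnn //.
  by rewrite (eqP (lker0_amull (divA _ nz_x))) capv0.
have: 1 \in (amull x @: V)%VS by rewrite xV.
by case/memv_imgP=> y Vy e; exists y => //; rewrite e lfunE.
Qed.

(** Gives access to the field theory of [fieldExtType]: V itself, with the multiplication of A, is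
    made into such an L, and f is the inclusion. *)
Lemma extension_field_ahom V :
  extension_field V ->
  exists (L : fieldExtType F) (f : 'AHom(L, A)), limg f = V.
Proof.
case=> V1 VM VC VV.
have asV : is_aspace V.
  by rewrite /is_aspace has_algid1 //=; apply/prodvP.
pose W := ASpace asV; pose T := subvs_of W.
have algidW : algid W = 1 by apply/eqP; rewrite algid_eq1.
have mulTC : commutative (@GRing.mul T).
  by move=> x y; apply: val_inj; apply: VC; apply: subvsP.
have fieldT : GRing.field_axiom T.
  move=> x nz_x.
  have [||y Vy xy] := VV (vsval x); first exact: (subvsP x).
    by apply: contra nz_x => /eqP x0; apply/eqP/val_inj.
  apply/unitrP; exists (Subvs (Vy : y \in W)).
  rewrite mulTC; split; apply: val_inj => /=;
  by rewrite algidW -?xy // VC //; exact: (subvsP x).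
pose comT := GRing.PzRing_hasCommutativeMul.Build T mulTC.
pose T1 : comUnitRingType := HB.pack T comT.
pose fT := GRing.ComUnitRing_isField.Build T1 fieldT.
pose L : fieldExtType F := HB.pack T comT fT.
pose v : L -> A := vsval : T -> A.
have vlin : linear v by move=> a x y.
have vmon : monoid_morphism v by split; first exact: algidW.
pose vL := GRing.isLinear.Build F L A *:%R v vlin.
pose vM := GRing.isMonoidMorphism.Build L A v vmon.
pose f : {lrmorphism L -> A} := HB.pack v vL vM.
exists L, (linfun_ahom f); apply/vspaceP=> x; apply/memv_imgP/idP.
  by case=> y _ ->; rewrite lfunE; exact: (subvsP (y : T)).
by move=> Vx; exists (Subvs (Vx : x \in W)); rewrite ?memvf // lfunE.
Qed.

Lemma ahom_scalar (L : fieldExtType F) (f : 'AHom(L, A)) x :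
  (f x \in 1%VS) = (x \in 1%VS).
Proof.
apply/vlineP/vlineP=> -[c e]; exists c; last by rewrite e linearZ rmorph1.
have fc : f (c *: 1) = c *: 1 by rewrite linearZ rmorph1.
by apply: (@fmorph_inj _ _ f); apply: etrans e _; rewrite -fc.
Qed.

Lemma dim_limg_ahom (L : fieldExtType F) (f : 'AHom(L, A)) :
  \dim (limg f) = \dim {:L}.
Proof.
apply: limg_dim_eq; apply/eqP; rewrite -subv0; apply/subvP => x.
rewrite memv_cap memvf memv_ker memv0 /= => /eqP fx0.
by rewrite -(fmorph_eq0 f); apply/eqP.
Qed.

End SubalgebraFields.

(** The conclusion is an equality of structures, so that L can be replaced by L' in a context that
    already contains maps and elements of L. *)
Lemma splitting_fieldExt (F : fieldType) (L : fieldExtType F) (p : {poly L}) :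
    p \is a polyOver 1%VS -> splittingFieldFor 1 p {:L} ->
  exists L' : splittingFieldType F, L' = L :> fieldExtType F.
Proof.
move=> p1 splp.
pose spl := FieldExt_isSplittingField.Build F L (ex_intro2 _ _ p p1 splp).
pose L' : splittingFieldType F := HB.pack (FieldExt.sort L) spl.
by exists L'; case: L p p1 splp spl @L'.
Qed.

(** * The morphisms D[X] -> D(X) and D[X] -> D *)

Lemma esc_incl_mul (F : fieldType) (D : falgType F) (R : comNzRingType)
    (phi : {rmorphism F -> R}) (a b : D) :
  esc_incl phi (a * b) = esc_incl phi a * esc_incl phi b.
Proof. exact: esc_inclM. Qed.

Section Evaluation.

Variables (Z : fieldType) (D : falgType Z) (q : nat).
Implicit Types (a b : poly_alg D q) (c : {mpoly Z[q]}) (lam : 'I_q -> Z).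

Lemma poly_alg_incl_zmod : zmod_morphism (@poly_alg_incl Z D q).
Proof. by move=> a b; rewrite /poly_alg_incl map_mxB. Qed.

HB.instance Definition _ := GRing.isZmodMorphism.Build
  (poly_alg D q) (ratfun_alg D q) (@poly_alg_incl Z D q) poly_alg_incl_zmod.

Lemma poly_alg_inclZ c a : poly_alg_incl (c *: a) = tofrac c *: poly_alg_incl a.
Proof. by rewrite /poly_alg_incl map_mxZ. Qed.

(** By bilinearity it is enough to compare products of basis elements of D, on which the map is the
    identity of D. *)
Lemma poly_alg_incl_monoid : monoid_morphism (@poly_alg_incl Z D q).
Proof.
have inclE d : poly_alg_incl (esc_incl (@mpolyC q Z) d)
             = esc_incl (ratfun_const Z q) d.
  by apply/rowP=> i; rewrite !mxE.
split=> [|a b]; first exact: inclE.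
rewrite [a in LHS]esc_decomp [b in LHS]esc_decomp.
rewrite mulr_suml raddf_sum.
apply: eq_bigr => i _; rewrite mulr_sumr raddf_sum; apply: eq_bigr => j _ /=.
rewrite -scalerAl -scalerAr scalerA poly_alg_inclZ rmorphM !mxE.
by rewrite -!esc_incl_mul inclE.
Qed.

HB.instance Definition _ := GRing.isMonoidMorphism.Build
  (poly_alg D q) (ratfun_alg D q) (@poly_alg_incl Z D q) poly_alg_incl_monoid.

Lemma poly_alg_incl_inj : injective (@poly_alg_incl Z D q).
Proof.
move=> a b /rowP eq_ab; apply/rowP=> i; have:= eq_ab i.
by rewrite !mxE => /eqP; rewrite tofrac_eq => /eqP.
Qed.

Lemma eval_algE lam a :
  eval_alg lam a = \sum_i (a 0 i).@[lam] *: esc_basis i.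
Proof.
rewrite [LHS]esc_basisE; apply: eq_bigr => i _.
by rewrite r2vK mxE.
Qed.

Lemma eval_alg_zmod lam : zmod_morphism (@eval_alg Z D q lam).
Proof. by move=> a b; rewrite /eval_alg map_mxB linearB. Qed.

HB.instance Definition _ lam := GRing.isZmodMorphism.Build
  (poly_alg D q) D (@eval_alg Z D q lam) (@eval_alg_zmod lam).

Lemma eval_algZ lam c a : eval_alg lam (c *: a) = c.@[lam] *: eval_alg lam a.
Proof. by rewrite /eval_alg map_mxZ linearZ. Qed.

Lemma eval_alg_incl lam (d : D) : eval_alg lam (esc_incl (@mpolyC q Z) d) = d.
Proof.
have:= eval_alg_tensor lam d 1.
by rewrite /esc_tensor scale1r meval1 scale1r.
Qed.

Lemma eval_alg_monoid lam : monoid_morphism (@eval_alg Z D q lam).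
Proof.
split=> [|a b]; first exact: (eval_alg_incl lam 1).
rewrite [a in LHS]esc_decomp [b in LHS]esc_decomp.
rewrite mulr_suml raddf_sum /= !eval_algE mulr_suml.
apply: eq_bigr => i _; rewrite mulr_sumr raddf_sum mulr_sumr.
apply: eq_bigr => j _ /=.
rewrite -!(scalerAl, scalerAr) !scalerA eval_algZ mevalM.
by rewrite -esc_incl_mul eval_alg_incl.
Qed.

HB.instance Definition _ lam := GRing.isMonoidMorphism.Build
  (poly_alg D q) D (@eval_alg Z D q lam) (@eval_alg_monoid lam).

End Evaluation.

(** * Nonvanishing polynomials and rank semicontinuity *)

Lemma poly_nonvanishing (Z : fieldType) (p : {poly Z}) :
    (forall s : seq Z, exists x, x \notin s) -> p != 0 ->
  exists x, p.[x] != 0.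
Proof.
move=> Zinf nz_p.
have [s us ss]: exists2 s : seq Z, uniq s & size s = size p.
  elim: (size p) => [|n [s us ss]]; first by exists [::].
  have [x xs] := Zinf s; exists (x :: s); first by rewrite /= xs.
  by rewrite /= ss.
have: ~~ all (root p) s.
  apply: contraL (leqnn (size p)) => ps.
  by rewrite -ltnNge -{1}ss; exact: max_poly_roots.
by case/allPn=> x _ px; exists x.
Qed.

(** Uniqueness of digits in base B: the last digit is the residue modulo B, and the others follow by
    induction. *)
Lemma base_expansion_inj (B n : nat) (a b : 'I_n -> nat) :
    (forall i, a i < B)%N -> (forall i, b i < B)%N ->
    (\sum_i a i * B ^ i = \sum_i b i * B ^ i)%N -> a =1 b.
Proof.
elim: n a b => [|n IHn] a b aB bB; first by move=> _ [].
have expand (c : 'I_n.+1 -> nat) :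
    (\sum_i c i * B ^ i
     = (\sum_(i < n) c (lift ord0 i) * B ^ i) * B + c ord0)%N.
  rewrite big_ord_recl muln1 addnC big_distrl /=; congr (_ + _)%N.
  by apply: eq_bigr => i _; rewrite -mulnA -expnSr.
have B_gt0 : (0 < B)%N by apply: leq_trans (aB ord0).
rewrite !expand => eq_ab.
have eq0 : a ord0 = b ord0.
  have := congr1 (modn^~ B) eq_ab.
  by rewrite !modnMDl !modn_small.
move/eqP: eq_ab; rewrite eq0 eqn_add2r eqn_pmul2r // => /eqP eq_ab i.
case: (unliftP ord0 i) => [j ->|-> //].
exact: (IHn (fun j => a (lift ord0 j)) (fun j => b (lift ord0 j))).
Qed.

(* Kronecker's substitution [u_i := t ^ (B ^ i)], for [B] larger than all     *)
(* exponents in [f], maps the monomials of [f] to distinct powers of [t].     *)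
Lemma mpoly_nonvanishing (Z : fieldType) (q : nat) (f : {mpoly Z[q]}) :
    (forall s : seq Z, exists x, x \notin s) -> f != 0 ->
  exists lam : 'I_q -> Z, f.@[lam] != 0.
Proof.
move=> Zinf nz_f; pose B := msize f.
pose N (m : 'X_{1..q}) := (\sum_i m i * B ^ i)%N.
have ltB m i : m \in msupp f -> (m i < B)%N.
  move=> mf; apply: leq_ltn_trans (msize_mdeg_lt mf).
  by rewrite mdegE (bigD1 i) //= leq_addr.
have Ninj : {in msupp f &, injective N}.
  move=> m1 m2 f1 f2 eqN; apply/mnmP.
  by apply: base_expansion_inj eqN => i; apply: ltB.
pose g : {poly Z} := \sum_(m <- msupp f) f@_m *: 'X^(N m).
have nz_g : g != 0.
  have [m mf] : exists m, m \in msupp f.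
    by exists (mlead f); apply: mlead_supp.
  apply/eqP => /(congr1 (fun p : {poly Z} => p`_(N m))).
  rewrite coef0 coef_sum (bigD1_seq m) ?msupp_uniq //= coefZ coefXn eqxx mulr1.
  rewrite big_seq_cond big1 ?addr0 => [/eqP|m' /andP[m'f ne_m]].
    by apply/negP; rewrite -mcoeff_msupp.
  rewrite coefZ coefXn (inj_in_eq Ninj) // eq_sym (negPf ne_m) mulr0 //.
have [t gt] := poly_nonvanishing Zinf nz_g.
exists (fun i => t ^+ (B ^ i)); apply: contra gt => /eqP ft0.
rewrite -ft0 mevalE horner_sum; apply/eqP/eq_bigr => m _.
rewrite hornerZ hornerXn; congr (_ * _).
rewrite /N -prodrXr; apply: eq_bigr => i _.
by rewrite mulnC exprM.
Qed.

Lemma generically_nonvanishing (Z : fieldType) (q : nat) (f : {mpoly Z[q]})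
    (P : ('I_q -> Z) -> Prop) :
    (forall s : seq Z, exists x, x \notin s) -> f != 0 ->
    (forall lam, f.@[lam] != 0 -> P lam) ->
  generically P.
Proof.
move=> Zinf nz_f fP; exists (fun lam => f.@[lam] != 0); split=> //.
  exists (eq f) => lam; split=> [flam|[_ <-] //]; by exists f.
exact: mpoly_nonvanishing.
Qed.

(** Computed on a representative of the class x in the quotient defining the fraction field. *)
Lemma fraction_denominator (R : idomainType) (x : {fraction R}) :
  exists2 d : R, d != 0 & exists n : R, tofrac d * x = tofrac n.
Proof.
elim/quotW: x => r; exists (frac r).2; first exact: denom_ratioP.
exists (frac r).1; unlock tofrac; rewrite -[LHS]FracField.pi_mul.
apply/eqmodP; rewrite /= FracField.equivfE /FracField.mulf.
by rewrite !numden_Ratio ?mul1r ?mulr1 ?oner_neq0 ?denom_ratioP // mulrC.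
Qed.

Lemma fraction_common_denominator (R : idomainType) (I : finType)
    (x : I -> {fraction R}) :
  exists2 d : R, d != 0 &
    exists n : I -> R, forall i, tofrac d * x i = tofrac (n i).
Proof.
have /fin_all_exists2[d nz_d dx] i := fraction_denominator (x i).
exists (\prod_i d i); first by apply/prodf_neq0 => i _.
have /fin_all_exists[n nx] := dx.
exists (fun i => (\prod_(j | j != i) d j) * n i) => i.
rewrite (bigD1 i) //= !tofracM -nx mulrA; congr (_ * _); exact: mulrC.
Qed.

Section RankSemicontinuity.

Lemma mxrank_minor (F : fieldType) (m n : nat) (A : 'M[F]_(m, n)) :
  exists (f : 'I_(\rank A) -> 'I_m) (g : 'I_(\rank A) -> 'I_n),
    \det (mxsub f g A) != 0.
Proof.
have fullBT : row_full (rowsub (maxrankfun A) A)^T.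
  by rewrite /row_full mxrank_tr; exact: maxrowsub_free.
exists (maxrankfun A), (fullrankfun fullBT).
have := fullrowsub_unit fullBT; move: (fullrankfun _) => g.
rewrite unitmxE unitfE -det_tr; congr (\det _ != 0).
by apply/matrixP=> i j; rewrite !mxE.
Qed.

Lemma minor_leq_mxrank (F : fieldType) (m n r : nat) (A : 'M[F]_(m, n))
    (f : 'I_r -> 'I_m) (g : 'I_r -> 'I_n) :
  \det (mxsub f g A) != 0 -> (r <= \rank A)%N.
Proof.
rewrite -unitfE -unitmxE => /mxrank_unit {1}<-.
rewrite (_ : mxsub f g A = colsub g (rowsub f A)); last first.
  by apply/matrixP=> i j; rewrite !mxE.
apply: leq_trans (mxrankS (rowsub_sub f A)).
rewrite -mxrank_tr trmx_mxsub -[X in (_ <= X)%N]mxrank_tr.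
exact: mxrankS (rowsub_sub _ _).
Qed.

Variables (Z : fieldType) (q m n : nat) (M : 'M[{mpoly Z[q]}]_(m, n)).

(** Minors commute with evaluation, and a minor that is nonzero at [lam] is a nonzero polynomial. *)
Lemma mxrank_meval_leq (lam : 'I_q -> Z) :
  (\rank (map_mx (meval lam) M) <= \rank (map_mx (@tofrac _) M))%N.
Proof.
have [f [g]] := mxrank_minor (map_mx (meval lam) M).
rewrite -map_mxsub det_map_mx => nz_det.
apply: (@minor_leq_mxrank _ _ _ _ _ f g).
rewrite -map_mxsub det_map_mx tofrac_eq0.
by apply: contraNneq nz_det => ->; rewrite rmorph0.
Qed.

Lemma mxrank_meval_generic :
  exists2 f : {mpoly Z[q]}, f != 0 & forall lam, f.@[lam] != 0 ->
    \rank (map_mx (meval lam) M) = \rank (map_mx (@tofrac _) M).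
Proof.
have [f [g]] := mxrank_minor (map_mx (@tofrac _) M).
rewrite -map_mxsub det_map_mx tofrac_eq0 => nz_det.
exists (\det (mxsub f g M)) => // lam nz_lam.
apply/eqP; rewrite eqn_leq mxrank_meval_leq /=.
apply: (@minor_leq_mxrank _ _ _ _ _ f g).
by rewrite -map_mxsub det_map_mx.
Qed.

End RankSemicontinuity.

(** * Independence and specialization *)

Section Independence.

Variables (Z : fieldType) (D : falgType Z) (q m k : nat).
Variable a : 'I_m -> 'I_k -> poly_alg D q.

Local Notation E := {fraction {mpoly Z[q]}}.

(** Row i concatenates the coordinates of the k elements [a i j], so row independence means joint
    independence of vectors in a k-fold power of the algebra. Bases use k = 1; commutators with a
    basis of V use k = [\dim V]. *)
Definition coordinate_matrix : 'M[{mpoly Z[q]}]_(m, k * dim D) :=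
  \matrix_i mxvec (\matrix_j (a i j : 'rV_(dim D))).

Lemma row_free_incl :
  row_free (map_mx (@tofrac _) coordinate_matrix) <->
  (forall c : 'I_m -> E,
     (forall j, \sum_i c i *: poly_alg_incl (a i j) = 0) -> forall i, c i = 0).
Proof.
split=> [free_a c a0 i | free_a].
  have/(row_free_inj free_a)/rowP/(_ i) :
      (\row_i c i) *m map_mx (@tofrac _) coordinate_matrix
      = 0 *m map_mx (@tofrac _) coordinate_matrix.
    rewrite mul0mx; apply/rowP=> jl; case/mxvec_indexP: jl => j l.
    have/rowP/(_ l) := a0 j; rewrite summxE !mxE => e; rewrite -[RHS]e.
    by apply: eq_bigr => i' _; rewrite !mxE mxvecE mxE.
  by rewrite !mxE.
apply: inj_row_free => v va0; apply/rowP=> i; rewrite [RHS]mxE.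
apply: free_a => j; apply/rowP=> l.
have/rowP/(_ (mxvec_index j l)) := va0; rewrite summxE !mxE => e.
rewrite -[RHS]e.
by apply: eq_bigr => i' _; rewrite !mxE mxvecE mxE.
Qed.

Lemma row_free_eval lam :
  row_free (map_mx (meval lam) coordinate_matrix) <->
  (forall c : 'I_m -> Z,
     (forall j, \sum_i c i *: eval_alg lam (a i j) = 0) -> forall i, c i = 0).
Proof.
have eqE (c : 'I_m -> Z) : (\row_i c i) *m map_mx (meval lam) coordinate_matrix
    = mxvec (\matrix_j v2r (\sum_i c i *: eval_alg lam (a i j))).
  apply/rowP=> jl; case/mxvec_indexP: jl => j l.
  rewrite mxvecE !mxE linear_sum summxE; apply: eq_bigr => i _.
  by rewrite linearZ /= r2vK !mxE mxvecE mxE.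
split=> [free_a c a0 i | free_a].
  have/(row_free_inj free_a)/rowP/(_ i) :
      (\row_i c i) *m map_mx (meval lam) coordinate_matrix
      = 0 *m map_mx (meval lam) coordinate_matrix.
    rewrite mul0mx eqE; apply/rowP=> jl; case/mxvec_indexP: jl => j l.
    by rewrite mxvecE mxE a0 linear0 !mxE.
  by rewrite !mxE.
apply: inj_row_free => v va0; apply/rowP=> i; rewrite [RHS]mxE.
apply: free_a => j; apply: v2r_inj; rewrite linear0; apply/rowP=> l.
have/rowP/(_ (mxvec_index j l)) := va0.
have {1}-> : v = \row_i v 0 i by apply/rowP=> i'; rewrite mxE.
by rewrite eqE mxvecE !mxE.
Qed.

Lemma generic_independence :
    (forall c : 'I_m -> E,
       (forall j, \sum_i c i *: poly_alg_incl (a i j) = 0) ->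
     forall i, c i = 0) ->
  exists2 f : {mpoly Z[q]}, f != 0 & forall lam, f.@[lam] != 0 ->
    forall c : 'I_m -> Z,
     (forall j, \sum_i c i *: eval_alg lam (a i j) = 0) -> forall i, c i = 0.
Proof.
move/row_free_incl => free_a.
have [f nz_f fP] := mxrank_meval_generic coordinate_matrix.
exists f => // lam /fP rk_a; apply/row_free_eval.
by rewrite /row_free rk_a.
Qed.

Lemma independence_of_eval lam :
    (forall c : 'I_m -> Z,
     (forall j, \sum_i c i *: eval_alg lam (a i j) = 0) -> forall i, c i = 0) ->
  forall c : 'I_m -> E,
     (forall j, \sum_i c i *: poly_alg_incl (a i j) = 0) -> forall i, c i = 0.
Proof.
move/row_free_eval => free_a; apply/row_free_incl.
rewrite /row_free eqn_leq rank_leq_row /=.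
by apply: leq_trans (mxrank_meval_leq _ lam); rewrite (eqP free_a).
Qed.

End Independence.

Section Specialization.

Variables (Z : fieldType) (D : falgType Z) (q : nat).
Implicit Types (a : poly_alg D q) (x : ratfun_alg D q) (lam : 'I_q -> Z).

Lemma common_denominator (I : finType) (x : I -> ratfun_alg D q) :
  exists2 d : {mpoly Z[q]}, d != 0 &
    exists a : I -> poly_alg D q,
      forall i, poly_alg_incl (a i) = tofrac d *: x i.
Proof.
pose y (il : I * 'I_(dim D)) := (x il.1 : 'rV_(dim D)) 0 il.2.
have [d nz_d [n nE]] := fraction_common_denominator y.
exists d => //; exists (fun i => \row_l n (i, l)) => i.
by apply/rowP=> l; rewrite !mxE -nE.
Qed.

Lemma eval_generic_neq0 a : a != 0 ->
  exists2 f : {mpoly Z[q]}, f != 0 & forall lam, f.@[lam] != 0 ->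
    eval_alg lam a != 0.
Proof.
move=> nz_a; pose a_ (i j : 'I_1) := a.
have [|f nz_f fP] := @generic_independence Z D q 1 1 a_.
  move=> c /(_ 0); rewrite big_ord1 => /eqP.
  rewrite scaler_eq0 => /orP[/eqP c0 i|].
    by rewrite ord1.
  rewrite -(rmorph0 (@poly_alg_incl Z D q)).
  by rewrite (inj_eq (@poly_alg_incl_inj _ _ _)) (negPf nz_a).
exists f => // lam /fP fl; apply/eqP => a0.
suff /(_ 0)/eqP: forall i : 'I_1, 1 = 0 :> Z by rewrite oner_eq0.
by apply: (fl (fun=> 1)) => j; rewrite big_ord1 /a_ a0 scaler0.
Qed.

(** D[X] meets Z(X) in Z[X]: at an index where 1 has a nonzero coordinate in Z, dividing the
    coordinate of a by it recovers the scalar, which is therefore a polynomial. *)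
Lemma poly_alg_incl_scalar a :
  poly_alg_incl a \in 1%VS -> exists c : {mpoly Z[q]}, a = c *: 1.
Proof.
case/vlineP=> r e.
have [i nz_i] : exists i, v2r (1 : D) 0 i != 0.
  apply/existsP; rewrite -negb_forall.
  apply: contraNN (oner_neq0 D) => /forallP v0.
  by apply/eqP/v2r_inj; rewrite linear0; apply/rowP=> i; rewrite mxE; apply/eqP.
exists ((v2r (1 : D) 0 i)^-1 *: a 0 i).
apply: poly_alg_incl_inj; rewrite e poly_alg_inclZ rmorph1; congr (_ *: _).
have /rowP/(_ i) := e; rewrite !mxE /= -mul_mpolyC tofracM => ->.
rewrite mulrCA -rmorphM /= -mpolyCM mulVf // mulr1 //.
Qed.

Lemma specialization_mul (V : {vspace ratfun_alg D q}) lam :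
    {in V &, forall x y, x * y \in V} ->
  {in specialization V lam &, forall x y : D, x * y \in specialization V lam}.
Proof.
move=> VM _ _ /specializationP[a Va <-] /specializationP[b Vb <-].
by apply/specializationP; exists (a * b); rewrite rmorphM //= VM.
Qed.

Lemma specialization_extension_field (K : {vspace ratfun_alg D q}) lam :
    (forall x : D, x != 0 -> x \is a GRing.unit) ->
  extension_field K -> extension_field (specialization K lam).
Proof.
move=> divD [K1 KM KC _]; apply: subalgebra_extension_field => //.
- by apply/specializationP; exists 1; rewrite rmorph1.
- exact: specialization_mul.
move=> _ _ /specializationP[a Ka <-] /specializationP[b Kb <-].
by rewrite -!rmorphM; congr (eval_alg _ _); apply: poly_alg_incl_inj;
   rewrite !rmorphM KC.
Qed.

(** A basis of the specialization lifts to elements of V in D[X], which remain independent over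
    Z(X). *)
Lemma dim_specialization_leq (V : {vspace ratfun_alg D q}) lam :
  (\dim (specialization V lam) <= \dim V)%N.
Proof.
set W := specialization V lam.
have /fin_all_exists2[a aV aE] (i : 'I_(\dim W)) :
    in_specialization V lam (vbasis W)`_i.
  by apply/specializationP/vbasis_mem/mem_nth; rewrite size_tuple.
have free_a : free [tuple poly_alg_incl (a i) | i < \dim W].
  apply/freeP => c; under eq_bigr do rewrite -tnth_nth tnth_mktuple.
  move=> c0.
  apply: (@independence_of_eval Z D q _ 1 (fun i _ => a i) lam) => //.
  move=> c' /(_ 0); under eq_bigr do rewrite aE.
  by apply/freeP; exact: basis_free (vbasisP W).
rewrite -[X in (X <= _)%N](size_tuple [tuple poly_alg_incl (a i) | i < \dim W]).
move: free_a; rewrite /free => /eqP <-; apply: dimvS.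
by apply/span_subvP => _ /mapP[i _ ->].
Qed.

Lemma polynomial_basis (V : {vspace ratfun_alg D q}) :
  exists b : 'I_(\dim V) -> poly_alg D q,
    basis_of V [tuple poly_alg_incl (b i) | i < \dim V].
Proof.
have [d nz_d [b bE]] :=
  common_denominator (fun i : 'I_(\dim V) => (vbasis V)`_i).
exists b; rewrite basisEfree; apply/and3P; split.
- apply/freeP => c; under eq_bigr do rewrite -tnth_nth tnth_mktuple bE scalerA.
  have /freeP free_V := basis_free (vbasisP V).
  move/(free_V (fun i => c i * tofrac d)) => cd0 i.
  by have /eqP := cd0 i; rewrite mulf_eq0 tofrac_eq0 (negPf nz_d) orbF => /eqP.
- apply/span_subvP => _ /mapP[i _ ->]; rewrite bE rpredZ //.
  by apply/vbasis_mem/mem_nth; rewrite size_tuple.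
by rewrite size_tuple.
Qed.

End Specialization.

(** * Generic dimension, centralizers and maximal subfields *)

Section GenericDimension.

Variables (Z : fieldType) (D : falgType Z) (q : nat).
Implicit Types (V : {vspace ratfun_alg D q}) (lam : 'I_q -> Z).

Lemma dim_specialization_generic V :
  exists2 f : {mpoly Z[q]}, f != 0 & forall lam, f.@[lam] != 0 ->
    \dim (specialization V lam) = \dim V.
Proof.
have [b bV] := polynomial_basis V.
have [|f nz_f fP] := @generic_independence Z D q _ 1 (fun i _ => b i).
  have /freeP free_b := basis_free bV.
  move=> c /(_ 0) c0; apply: free_b.
  by under eq_bigr do rewrite -tnth_nth tnth_mktuple.
exists f => // lam /fP free_b; apply/eqP.
rewrite eqn_leq dim_specialization_leq /=.
pose X := [tuple eval_alg lam (b i) | i < \dim V].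
have free_X : free X.
  apply/freeP => c; under eq_bigr do rewrite -tnth_nth tnth_mktuple.
  by move=> c0; apply: free_b => j.
rewrite -[X in (X <= _)%N](size_tuple X).
move: free_X; rewrite /free => /eqP <-.
apply/dimvS/span_subvP => _ /mapP[i _ ->]; apply/specializationP.
exists (b i) => //; apply: (basis_mem bV).
by apply/mapP; exists i; rewrite ?mem_enum.
Qed.

Lemma dim_ratfun_alg : \dim {:ratfun_alg D q} = \dim {:D}.
Proof. by rewrite !dimvf [LHS]mul1n. Qed.

(* The commutators with a basis of [V] are jointly injective on a complement  *)
(* of ['C(V)], hence generically also on the specialization of a basis of it. *)
Lemma dim_centralizer_specialization V :
  exists2 f : {mpoly Z[q]}, f != 0 & forall lam, f.@[lam] != 0 ->
    (\dim 'C(specialization V lam) <= \dim 'C(V))%N.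
Proof.
have [b bV] := polynomial_basis V.
have [c cC] := polynomial_basis ('C(V)^C)%VS.
have [|f nz_f fP] :=
    @generic_independence Z D q _ _ (fun j i => c j * b i - b i * c j).
  move=> x x0; pose y := \sum_j x j *: poly_alg_incl (c j).
  have yX : y = \sum_j x j *: [tuple poly_alg_incl (c j) | j < _]`_j.
    by apply: eq_bigr => j _; rewrite -tnth_nth tnth_mktuple.
  have /freeP free_c := basis_free cC.
  suff y0: y = 0 by apply: free_c; rewrite -yX.
  (* [y] commutes with the basis [b] of V, hence lies in the centralizer; it also lies in the chosen
     complement, as a combination of the [c j]. *)
  apply/eqP; rewrite -memv0 -(capv_compl 'C(V)) memv_cap; apply/andP; split.
    apply/centvP => v Vv; rewrite (coord_basis bV Vv) mulr_sumr mulr_suml.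
    apply: eq_bigr => i _; rewrite -scalerAl -scalerAr; congr (_ *: _).
    rewrite -tnth_nth tnth_mktuple; apply/eqP.
    rewrite -subr_eq0 -[X in _ == X](x0 i).
    apply/eqP; rewrite mulr_suml mulr_sumr -sumrB; apply: eq_bigr => j _.
    by rewrite rmorphB !rmorphM /= scalerBr -scalerAl -scalerAr.
  apply: rpred_sum => j _; apply: rpredZ; apply: (basis_mem cC).
  by apply/mapP; exists j; rewrite ?mem_enum.
exists f => // lam /fP free_a.
set C := 'C(_)%VS; pose X := [tuple eval_alg lam (c j) | j < \dim 'C(V)^C].
have bW i : eval_alg lam (b i) \in specialization V lam.
  apply/specializationP; exists (b i) => //; apply: (basis_mem bV).
  by apply/mapP; exists i; rewrite ?mem_enum.
have indepX (x : 'I_(\dim 'C(V)^C) -> Z) :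
    \sum_j x j *: X`_j \in C -> forall j, x j = 0.
  under eq_bigr do rewrite -tnth_nth tnth_mktuple.
  move/centvP=> Cx; apply: free_a => i.
  apply/eqP; have/eqP := Cx _ (bW i).
  rewrite -subr_eq0 mulr_suml mulr_sumr -sumrB.
  congr (_ == 0); apply: eq_bigr => j _.
  by rewrite rmorphB !rmorphM /= scalerBr -scalerAl -scalerAr.
have free_X : free X by apply/freeP => x x0; apply: indepX; rewrite x0 mem0v.
have disj : (C :&: <<X>> = 0)%VS.
  apply/eqP; rewrite -subv0; apply/subvP => v; rewrite memv_cap => /andP[Cv].
  move=> Xv; move: Cv; rewrite (coord_span Xv) => /indepX x0.
  by rewrite big1 ?mem0v // => j _; rewrite x0 scale0r.
(* The span of X has the dimension of the complement of ['C(V)] and meets C trivially, which bounds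
   the dimension of C in D. *)
have := dimvS (subvf (C + <<X>>)%VS); rewrite dimv_disjoint_sum //.
rewrite (eqP (free_X : _ == _)) size_tuple -dim_ratfun_alg.
have [sub1 sub2] := (dimvS (subvf 'C(V)), dimv_compl 'C(V)).
by rewrite sub2 addnBA // leq_subLR leq_add2r.
Qed.

(** The specialization W lies in its centralizer by commutativity, while generically dim C(W) <= dim
    C(V) = dim V = dim W. *)
Lemma maximal_subfield_specialization V :
    (forall x : D, x != 0 -> x \is a GRing.unit) -> maximal_subfield V ->
  exists2 f : {mpoly Z[q]}, f != 0 & forall lam, f.@[lam] != 0 ->
    maximal_subfield (specialization V lam).
Proof.
move=> divD [fieldV CV].
have [f nz_f fP] := dim_specialization_generic V.
have [g nz_g gP] := dim_centralizer_specialization V.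
exists (f * g) => [|lam]; first exact: mulf_neq0.
rewrite mevalM mulf_eq0 negb_or => /andP[/fP dimW /gP]; rewrite CV => dimC.
have fieldW := specialization_extension_field lam divD fieldV.
split=> //; apply/eqP; rewrite eq_sym eqEdim dimW dimC andbT.
case: fieldW => _ _ WC _; apply/subvP => u Wu.
by apply/centvP => v Wv; apply: WC.
Qed.

End GenericDimension.

(** * Purely inseparable extensions and their exponents *)

Section PurelyInseparable.

Variables (F : fieldType) (A : falgType F) (p : nat).

Lemma pinsep_extP (V : {vspace A}) r : p \in [pchar F] ->
  extension_field V -> {in V, forall x, x ^+ (p ^ r) \in 1%VS} -> pinsep_ext V.
Proof.
move=> charp fieldV Vp; have [L [f fV]] := extension_field_ahom fieldV.
exists L, f; split=> //; apply/purely_inseparableP => x _.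
apply/purely_inseparable_elementP_pchar; exists (p ^ r)%N.
  by rewrite pnatX pnatE ?(pcharf_prime charp) // (pchar_lalg L) charp.
by rewrite -(ahom_scalar f) rmorphXn Vp // -fV memv_img ?memvf.
Qed.

(** The exponent is the least admissible r, reached by descent; the case distinction is
    classical. *)
Lemma pinsep_ext_exponent_ex (V : {vspace A}) r : pinsep_ext V ->
    {in V, forall x, x ^+ (p ^ r) \in 1%VS} ->
  exists2 s, (s <= r)%N & pinsep_ext_exponent p V s.
Proof.
move=> insepV; elim/ltn_ind: r => r IHr Vr.
case: (classic (exists2 t,
  (t < r)%N & {in V, forall x, x ^+ (p ^ t) \in 1%VS})).
  case=> t lt_tr Vt; have [s le_st Vs] := IHr t lt_tr Vt.
  by exists s => //; apply: leq_trans le_st (ltnW lt_tr).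
move=> minr; exists r => //; split=> // s Vs; rewrite leqNgt.
by apply/negP => lt_sr; apply: minr; exists s.
Qed.

Lemma scalarX (x : A) m : x \in 1%VS -> x ^+ m \in 1%VS.
Proof.
by case/vlineP=> c ->; rewrite exprZn expr1n rpredZ ?memv_line.
Qed.

End PurelyInseparable.

Section SpecializationInseparable.

Variables (Z : fieldType) (D : falgType Z) (q : nat).
Implicit Types (a : poly_alg D q) (K : {vspace ratfun_alg D q}).
Implicit Type lam : 'I_q -> Z.

Lemma eval_alg_scalar a lam :
  poly_alg_incl a \in 1%VS -> eval_alg lam a \in 1%VS.
Proof.
case/poly_alg_incl_scalar=> c ->.
by rewrite eval_algZ rmorph1 rpredZ ?memv_line.
Qed.

(** Not being a scalar is the linear independence of a and 1, which persists generically. *)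
Lemma eval_generic_nonscalar a : poly_alg_incl a \notin 1%VS ->
  exists2 f : {mpoly Z[q]}, f != 0 & forall lam, f.@[lam] != 0 ->
    eval_alg lam a \notin 1%VS.
Proof.
move=> a1; pose b (i : 'I_2) (j : 'I_1) := if i == 0 then a else 1.
have [|f nz_f fP] := @generic_independence Z D q 2 1 b.
  move=> c /(_ 0); rewrite big_ord_recl big_ord1 /b /= rmorph1 => c0.
  have ca : c 0 = 0.
    apply: contraNeq a1 => nz_c; apply/vlineP.
    exists (- ((c 0)^-1 * c (lift 0 0))).
    apply/eqP; rewrite scaleNr -addr_eq0 -scalerA.
    rewrite -[poly_alg_incl a](scalerK nz_c) -scalerDr c0.
    by rewrite scaler0.
  move: c0; rewrite ca scale0r add0r => /eqP.
  rewrite scaler_eq0 oner_eq0 orbF => /eqP c1 i.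
  by case: (unliftP 0 i) => [j|] ->; rewrite ?ord1.
exists f => // lam /fP indep; apply/vlineP=> -[c e].
have/(_ 0)/eqP : forall i, (if i == 0 :> 'I_2 then 1 else - c) = 0.
  apply: indep => j; rewrite big_ord_recl big_ord1 /b /= rmorph1 e.
  by rewrite scale1r scaleNr subrr.
by rewrite oner_eq0.
Qed.

Lemma pinsep_specialization_pow K r lam p :
    {in K, forall x, x ^+ (p ^ r) \in 1%VS} ->
  {in specialization K lam, forall x : D, x ^+ (p ^ r) \in 1%VS}.
Proof.
move=> Kr _ /specializationP[a Ka <-].
by rewrite -rmorphXn eval_alg_scalar // rmorphXn Kr.
Qed.

Lemma pinsep_specialization K r p :
    p \in [pchar Z] -> (forall x : D, x != 0 -> x \is a GRing.unit) ->
    extension_field K -> pinsep_ext_exponent p K r ->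
  (forall lam, exists2 s, (s <= r)%N &
     pinsep_ext_exponent p (specialization K lam) s) /\
  exists2 f : {mpoly Z[q]}, f != 0 & forall lam, f.@[lam] != 0 ->
    pinsep_ext_exponent p (specialization K lam) r.
Proof.
move=> charp divD fieldK [_ Kr minr].
have insepW lam : pinsep_ext (specialization K lam).
  apply: (pinsep_extP (r := r) charp).
    exact: specialization_extension_field.
  exact: pinsep_specialization_pow.
split=> [lam|].
  by apply: pinsep_ext_exponent_ex => //; apply: pinsep_specialization_pow.
(* For exponent 0 nothing smaller has to be excluded; otherwise r now denotes the exponent minus
   one, and minimality provides an x whose p^r-th power is not a scalar. *)
case: r Kr minr insepW => [|r] Kr minr insepW.
  exists 1 => [|lam _]; first exact: oner_neq0.
  by split=> //; apply: pinsep_specialization_pow.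
have [x Kx xr] : exists2 x, x \in K & x ^+ (p ^ r) \notin 1%VS.
  apply: NNPP => noK; have: (r < r)%N; last by rewrite ltnn.
  apply: minr => x Kx; apply: contraT => xr; case: noK; by exists x.
have [d nz_d [a aE]] := common_denominator (fun _ : 'I_1 => x).
have nz_dF : tofrac d != 0 by rewrite tofrac_eq0.
have [|f nz_f fP] := @eval_generic_nonscalar (a 0 ^+ (p ^ r)).
  apply: contra xr; rewrite rmorphXn /= aE exprZn => dx.
  by rewrite -[x ^+ _](scalerK (expf_neq0 (p ^ r) nz_dF)) rpredZ.
exists f => // lam /fP; rewrite rmorphXn => ar.
split=> // [|s Ws]; first exact: pinsep_specialization_pow.
(* If some s <= r sufficed for the specialization, the p^r-th power of the specialized element would
   be a power of a scalar. *)
rewrite ltnNge; apply: contra ar => le_sr.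
rewrite -(subnKC le_sr) expnD exprM scalarX // Ws //.
by apply/specializationP; exists (a 0) => //; rewrite aE rpredZ.
Qed.

End SpecializationInseparable.

(** * Galois extensions *)

Section GaloisCriterion.

Variables (F : fieldType) (A : falgType F).

Variables (V : {vspace A}) (gT : finGroupType) (G : {group gT}) (a : gT -> A).
Hypotheses (V_field : extension_field V) (dimV : \dim V = #|G|).
Hypotheses (aV : {in G, forall s, a s \in V}) (a_inj : {in G &, injective a}).
Hypothesis a_free : forall c : 'I_#|G| -> F,
  \sum_i c i *: a 1%g ^+ i = 0 -> forall i, c i = 0.
Hypothesis a_poly :
  forall i, (\prod_(s <- enum G) ('X - (a s)%:P))`_i \in (1%VS : {vspace A}).
Variable Q : gT -> 'I_#|G| -> F.
Hypothesis a_Q : {in G &, forall t s, a (t * s)%g = \sum_i Q t i *: a s ^+ i}.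

(** The element [a 1] generates V because its first #|G| powers are independent, and it is a root of
    a separable polynomial over F that splits in V; hence V is Galois. An automorphism is determined
    by the index t with [a 1] sent to [a t]. Since the coefficients [Q t i] lie in F and do not
    depend on s, they force composition of automorphisms to follow the product of G. *)
Lemma galois_ext_group_of_conjugates : galois_ext_group V G.
Proof.
have [L [f fV]] := extension_field_ahom V_field.
(* The conjugates are transported to L; outside G the value 0 is a dummy. *)
have /fin_all_exists [b bE] (s : gT) : exists x : L, s \in G -> f x = a s.
  case Gs: (s \in G); last by exists 0.
  have:= aV Gs; rewrite -fV => /memv_imgP[x _ ->]; by exists x.
have finj : injective f := @fmorph_inj _ _ f.
pose rs := [seq b s | s <- enum G]; pose p := \prod_(x <- rs) ('X - x%:P).
have p1 : p \is a polyOver 1%VS.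
  apply/polyOverP => i; rewrite -(ahom_scalar f) -[f _]coef_map.
  suff -> : map_poly f p = \prod_(s <- enum G) ('X - (a s)%:P) by exact: a_poly.
  rewrite /p big_map rmorph_prod big_seq [RHS]big_seq; apply: eq_bigr => s.
  rewrite mem_enum => Gs.
  by rewrite rmorphB /= map_polyX map_polyC /= bE.
have sep_p : separable_poly p.
  rewrite separable_prod_XsubC map_inj_in_uniq ?enum_uniq // => s t.
  rewrite !mem_enum => Gs Gt eq_b; apply: a_inj => //.
  by rewrite -!bE ?eq_b.
have gen_b : <<1; b 1%g>>%VS = {:L}%VS.
  apply/eqP; rewrite eqEdim subvf -(dim_limg_ahom f) fV dimV.
  pose X := [tuple b 1%g ^+ i | i < #|G|].
  have free_X : free X.
    apply/freeP => c; under eq_bigr do rewrite -tnth_nth tnth_mktuple.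
    move=> c0; apply: a_free; rewrite -[RHS](linear0 (ahval f)) -c0 linear_sum.
    by apply: eq_bigr => i _; rewrite linearZ /= rmorphXn /= bE.
  rewrite -[X in (X <= _)%N](size_tuple X).
  move: free_X; rewrite /free => /eqP <-.
  by apply/dimvS/span_subvP => _ /mapP[i _ ->]; rewrite rpredX ?memv_adjoin.
have spl_p : splittingFieldFor 1 p {:L}.
  exists rs; first exact: eqpxx.
  apply/eqP; rewrite eqEsubv subvf -gen_b /=; apply/FadjoinP; split.
    exact: subv_adjoin_seq.
  by apply: seqv_sub_adjoin; apply/mapP; exists 1%g; rewrite ?mem_enum.
(* From here on L carries a splitting field structure, while f and b are kept. *)
have [L' eqL] := splitting_fieldExt p1 spl_p; subst L.
have galL : galois 1 {:L'} by apply/splitting_galoisField; exists p.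
exists L', f; split=> //; set H := 'Gal(_ / _)%g.
have cardH : #|H| = #|G|.
  by rewrite -galois_dim // dimv1 divn1 -(dim_limg_ahom f) fV.
have /fin_all_exists2 [t tG tE] (u : gal_of {:L'}) :
    exists2 s, s \in G & u \in H -> u (b 1%g) = b s.
  case Hu: (u \in H); last by exists 1%g.
  have : root p (u (b 1%g)).
    rewrite -(fixedPoly_gal (sub1v _) Hu p1) rmorph_root // root_prod_XsubC.
    by apply/mapP; exists 1%g; rewrite ?mem_enum.
  rewrite root_prod_XsubC => /mapP[s]; rewrite mem_enum => Gs ->.
  by exists s.
have binj : {in G &, injective b}.
  by move=> s s' Gs Gs' eq_b; apply: a_inj => //; rewrite -!bE ?eq_b.
(* In [gal_of] the product u * v applies u first. Write u (b 1) = b (t u) as a polynomial in b 1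
   with coefficients [Q (t u)] in F; then v replaces b 1 by b (t v), which yields b (t u * t v). *)
have tM : {in H &, {morph t : u v / (u * v)%g}}.
  move=> u v Hu Hv; apply: binj; rewrite ?groupM //.
  rewrite -tE ?groupM // galM ?memvf // tE //.
  have bQ s s' : s \in G -> s' \in G ->
      b (s * s')%g = \sum_i Q s i *: b s' ^+ i.
    move=> Gs Gs'; apply: finj; rewrite bE ?groupM // a_Q // linear_sum.
    by apply: eq_bigr => i _; rewrite linearZ /= rmorphXn /= bE.
  rewrite bQ // -{1}[t u]mulg1 bQ // linear_sum; apply: eq_bigr => i _.
  by rewrite linearZ /= rmorphXn /= tE.
have t_inj : {in H &, injective t}.
  move=> u v Hu Hv eq_t; apply/eqP/gal_eqP => x _.
  have : x \in <<1; b 1%g>>%VS by rewrite gen_b memvf.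
  case/Fadjoin_polyP=> r r1 ->.
  by rewrite -!horner_map !(fixedPoly_gal (sub1v _)) //= !tE // eq_t.
pose tm := Morphism tM.
have injt : ('injm tm)%g by apply/injmP.
apply/isogP; exists tm => //; apply/eqP.
rewrite eqEcard card_injm // cardH leqnn andbT.
by apply/subsetP => _ /morphimP[u _ _ ->]; apply: tG.
Qed.

End GaloisCriterion.

Section GaloisGenerator.

Variables (F : fieldType) (L : splittingFieldType F).
Hypothesis galL : galois 1 {:L}.
Local Notation G := 'Gal({:L}%VS / 1%VS)%g.

Lemma galois_cardE : #|G| = \dim {:L}.
Proof. by rewrite -galois_dim // dimv1 divn1. Qed.

Lemma galois_generator : exists y : L, <<1; y>>%VS = {:L}%VS.
Proof.
exists (separable_generator 1 {:L}); case/and3P: galL => _ sepL _.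
by apply/esym/eq_adjoin_separable_generator; rewrite ?sub1v.
Qed.

(** Allows denominators to be cleared from a generator. *)
Lemma adjoinZ (y : L) c : c != 0 -> <<1; c *: y>>%VS = <<1; y>>%VS.
Proof.
move=> nz_c; apply/eqP; rewrite eqEsubv; apply/andP; split.
  by apply/FadjoinP; rewrite subv_adjoin rpredZ ?memv_adjoin.
apply/FadjoinP; rewrite subv_adjoin -[X in X \in _](scalerK nz_c).
by rewrite rpredZ ?memv_adjoin.
Qed.

Variable y : L.
Hypothesis gen_y : <<1; y>>%VS = {:L}%VS.

Lemma powers_basis n : n = \dim {:L} -> basis_of {:L} [tuple y ^+ i | i < n].
Proof.
move=> ->; rewrite basisEfree subvf size_tuple leqnn !andbT.
apply/freeP => c; under eq_bigr do rewrite -tnth_nth tnth_mktuple.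
move=> c0; pose c' i : L := if insub i is Some j then (c j)%:A else 0.
pose p := \poly_(i < \dim {:L}) c' i.
have pE (i : 'I_(\dim {:L})) : p`_i = (c i)%:A.
  by rewrite coef_poly ltn_ord /c' valK.
have p1 : p \is a polyOver 1%VS.
  apply/polyOverP => i; rewrite coef_poly /c'.
  case: ltnP => // _; last exact: mem0v.
  by case: insub => [j|]; rewrite ?mem0v ?rpredZ ?memv_line.
have py : root p y.
  apply/rootP; rewrite (horner_coef_wide y (size_poly _ _)); apply: etrans c0.
  by apply: eq_bigr => i _; rewrite pE mulr_algl.
have p0 : p = 0.
  (* The minimal polynomial of y has size [\dim {:L}] plus one, which exceeds the size of p. *)
  apply/eqP/contraT => nz_p; have := dvdp_leq nz_p (minPoly_dvdp p1 py).
  rewrite size_minPoly adjoin_degreeE gen_y dimv1 divn1.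
  by move/leq_trans/(_ (size_poly _ _)); rewrite ltnn.
move=> i; have := pE i; rewrite p0 coef0 => /esym/eqP.
by rewrite scaler_eq0 oner_eq0 orbF => /eqP.
Qed.

(** Right translation by t permutes the factors, so the coefficients are fixed by the Galois
    group. *)
Lemma galois_orbit_poly :
  \prod_(s <- enum G) ('X - (s y)%:P) \is a polyOver 1%VS.
Proof.
apply/polyOverP => i; have/galois_fixedField fixG := galL.
set c := _`_i; have: c \in fixedField G; last by rewrite fixG.
apply/fixedFieldP; rewrite ?memvf // => t Gt.
rewrite -coef_map; congr ((_ : {poly L})`_i); rewrite rmorph_prod !big_enum /=.
rewrite [RHS](reindex_inj (mulIg t)) /=; apply: eq_big => [s|s Gs].
  by rewrite groupMr.
by rewrite rmorphB /= map_polyX map_polyC /= galM ?memvf.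
Qed.

Lemma gal_generator_inj : {in G &, injective (fun s : gal_of {:L} => s y)}.
Proof.
move=> s t Gs Gt eq_y; apply/eqP/gal_eqP => x _.
have : x \in <<1; y>>%VS by rewrite gen_y memvf.
case/Fadjoin_polyP=> r r1 ->.
by rewrite -!horner_map !(fixedPoly_gal (sub1v _)) //= eq_y.
Qed.

End GaloisGenerator.

Section GaloisSpecialization.

Variables (Z : fieldType) (D : falgType Z) (q : nat).
Variables (K : {vspace ratfun_alg D q}) (gT : finGroupType) (G : {group gT}).

(** The criterion is applied with the Galois group of K itself, whose conjugates of a generator are
    placed in D[X]; the isomorphism with G is composed at the end. *)
Lemma galois_specialization :
    (forall x : D, x != 0 -> x \is a GRing.unit) ->
    extension_field K -> galois_ext_group K G ->
  exists2 f : {mpoly Z[q]}, f != 0 & forall lam, f.@[lam] != 0 ->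
    galois_ext_group (specialization K lam) G.
Proof.
move=> divD fieldK [L [h [hK galL isoG]]].
have [y0 gen_y0] := galois_generator galL.
have [d nz_d [a aE0]] := common_denominator (fun s : gal_of {:L} => h (s y0)).
(* The scalar d is fixed by the Galois group, so one scaling of the generator puts all its
   conjugates in D[X]. *)
have gen_y : <<1; tofrac d *: y0>>%VS = {:L}%VS.
  by rewrite adjoinZ // tofrac_eq0.
have aE s : poly_alg_incl (a s) = h (s (tofrac d *: y0)).
  by rewrite aE0 !linearZ.
set y := tofrac d *: y0 in gen_y aE; clearbody y.
have hinj : injective h := @fmorph_inj _ _ h.
have basY := powers_basis gen_y (galois_cardE galL).
set H := 'Gal(_ / _)%g in isoG basY *; set Y := [tuple _ | _ < _] in basY.
(* e is a common denominator for the coordinates of all conjugates of y on the powers of y. *)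
have [e nz_e [Q QE]] := fraction_common_denominator
  (fun ti : gal_of {:L} * 'I_#|H| => coord Y ti.2 (ti.1 y)).
have aQ s t : e *: a (t * s)%g = \sum_i Q (t, i) *: a s ^+ i.
  apply: poly_alg_incl_inj; rewrite poly_alg_inclZ aE galM ?memvf //.
  rewrite [t y](coord_basis basY (memvf _)) !linear_sum rmorph_sum.
  apply: eq_bigr => i _; rewrite -tnth_nth tnth_mktuple !linearZ /= scalerA.
  have /= := QE (t, i); rewrite mulrC => ->.
  by rewrite poly_alg_inclZ !rmorphXn /= aE.
have dimK : \dim K = #|H| by rewrite -hK dim_limg_ahom galois_cardE.
have [f1 nz_f1 f1P] := dim_specialization_generic K.
have [|f2 nz_f2 f2P] :=
    @generic_independence Z D q #|H| 1 (fun j _ => a 1%g ^+ j).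
  have /freeP freeY := basis_free basY.
  move=> c /(_ 0) c0; apply: freeY.
  under eq_bigr => j _ do rewrite -tnth_nth tnth_mktuple.
  apply: hinj; rewrite linear0 linear_sum -[RHS]c0; apply: eq_bigr => j _.
  by rewrite linearZ /= !rmorphXn /= aE gal_id.
have /fin_all_exists2[g nz_g gP] (st : gal_of {:L} * gal_of {:L}) :
    exists2 g : {mpoly Z[q]}, g != 0 & forall lam, g.@[lam] != 0 ->
      st.1 \in H -> st.2 \in H ->
      eval_alg lam (a st.1) = eval_alg lam (a st.2) ->
      st.1 = st.2.
  (* Equal conjugates come from equal automorphisms, so the polynomial 1 serves; distinct ones are
     kept apart wherever their difference specializes to a nonzero element. *)
  case: st => s t /=; have [eq_a|ne_a] := eqVneq (a s) (a t).
    exists 1 => [|lam _ Hs Ht _]; first exact: oner_neq0.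
    apply: (gal_generator_inj gen_y Hs Ht); apply: hinj.
    by rewrite -!aE eq_a.
  have [|g nz_g gP] := @eval_generic_neq0 Z D q (a s - a t).
    by rewrite subr_eq0.
  exists g => // lam /gP nz_st _ _ eq_st.
  by rewrite rmorphB /= eq_st subrr eqxx in nz_st.
(* The factors secure, in order, the dimension, a generator, division by e at [lam], and distinct
   conjugates. *)
exists (f1 * f2 * e * \prod_st g st) => [|lam].
  by rewrite !mulf_neq0 //; apply/prodf_neq0 => st _.
rewrite !mevalM !mulf_eq0 !negb_or rmorph_prod.
case/andP=> /andP[/andP[/f1P dimW /f2P free_a] nz_elam] /prodf_neq0 nz_glam.
have fieldW := specialization_extension_field lam divD fieldK.
have galW : galois_ext_group (specialization K lam) H.
  apply: (@galois_ext_group_of_conjugates _ _ _ _ _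
    (fun s => eval_alg lam (a s)) fieldW _ _ _ _ _
    (fun t i => (e.@[lam])^-1 * (Q (t, i)).@[lam])).
  - by rewrite dimW.
  - move=> s _; apply/specializationP; exists (a s) => //.
    by rewrite aE -hK memv_img ?memvf.
  - move=> s t Hs Ht eq_st; exact: (gP (s, t) lam (nz_glam (s, t) isT)).
  - move=> c c0; apply: free_a => j; rewrite -[RHS]c0.
    by apply: eq_bigr => i _; rewrite rmorphXn.
  - move=> i.
    (* The orbit polynomial is formed over D[X]: its image in D(X) has scalar coefficients by Galois
       theory, hence so does its specialization. *)
    pose p : {poly poly_alg D q} := \prod_(s <- enum H) ('X - (a s)%:P).
    suff -> : \prod_(s <- enum H) ('X - (eval_alg lam (a s))%:P)
             = map_poly (eval_alg lam) p.
      rewrite coef_map; apply: eval_alg_scalar; rewrite -coef_map.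
      suff -> : map_poly (@poly_alg_incl Z D q) p
               = map_poly h (\prod_(s <- enum H) ('X - (s y)%:P)).
        rewrite coef_map ahom_scalar.
        by have /polyOverP := galois_orbit_poly galL y.
      rewrite !rmorph_prod; apply: eq_bigr => s _.
      by rewrite !rmorphB /= !map_polyX !map_polyC /= aE.
    rewrite rmorph_prod; apply: eq_bigr => s _.
    by rewrite rmorphB /= map_polyX map_polyC.
  move=> t s Ht Hs; rewrite -[LHS](scalerK nz_elam) -eval_algZ aQ.
  rewrite rmorph_sum scaler_sumr; apply: eq_bigr => i _ /=.
  by rewrite eval_algZ scalerA rmorphXn.
have [L' [h' [h'W galL' isoH]]] := galW; exists L', h'; split=> //.
exact: isog_trans isoH isoG.
Qed.

End GaloisSpecialization.

Theorem theorem1p2p4 (Z : fieldType) (D : falgType Z) (q : nat)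
    (Z_infinite : forall s : seq Z, exists x, x \notin s)
    (D_division : forall x : D, x != 0 -> x \is a GRing.unit)
    (D_central : 'Z({:D})%VS = 1%VS)
    (K : {vspace (ratfun_alg D q)}) (K_field : extension_field K) :
  [/\ [/\ forall lam, extension_field (specialization K lam),
          generically (fun lam : 'I_q -> Z =>
            \dim (specialization K lam) = \dim K) &
          maximal_subfield K ->
          generically (fun lam : 'I_q -> Z =>
            maximal_subfield (specialization K lam))],
      galois_ext K ->
        generically (fun lam : 'I_q -> Z => galois_ext (specialization K lam)) &
      forall p : nat, p \in [pchar Z] ->
        (forall r : nat, pinsep_ext_exponent p K r ->
           (forall lam, exists2 s : nat, (s <= r)%N &
              pinsep_ext_exponent p (specialization K lam) s) /\
           generically (fun lam : 'I_q -> Z =>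
             pinsep_ext_exponent p (specialization K lam) r)) /\
        (forall r : nat, galois_ext_group K [set: 'rV['F_p]_r] ->
           generically (fun lam : 'I_q -> Z =>
             galois_ext_group (specialization K lam) [set: 'rV['F_p]_r]))].
Proof.
have generic (P : ('I_q -> Z) -> Prop) :
    (exists2 f : {mpoly Z[q]}, f != 0 & forall lam, f.@[lam] != 0 -> P lam) ->
    generically P.
  by case=> f nz_f; apply: generically_nonvanishing.
split=> [|[L [f [fK galL]]]|p charp]; first split.
- by move=> lam; apply: specialization_extension_field.
- exact/generic/dim_specialization_generic.
- by move=> maxK; apply/generic/maximal_subfield_specialization.
(* Assertion (2) follows from the version with a prescribed group, taken to be the Galois group of
   K. *)
- apply: generic; have galK : galois_ext_group K 'Gal({:L} / 1).
    by exists L, f; split=> //; apply: isog_refl.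
  have [g nz_g gP] := galois_specialization D_division K_field galK.
  by exists g => // lam /gP[L' [f' [f'W galL' _]]]; exists L', f'.
split=> r Kr; last exact/generic/galois_specialization.
have [all_lam gen_lam] := pinsep_specialization charp D_division K_field Kr.
by split=> //; apply: generic.
Qed.
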